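(* Let $n\ge 1$, $b \geq 1$ be integers, let $f:\{0,1\}^n \rightarrow \{0,1\}$ be a total Boolean function that depends on all its inputs (i.e., it is not a junta on a strict subset of its inputs), and let $\epsilon \in (0, 1/2)$. Let $\mathsf{IP} : \{0, 1\}^b \times \{0, 1\}^b \to \{0, 1\}$ be the Inner Product function. Then $\mathsf{Q}^{\rightarrow,\epsilon}_{\mathrm{cc}}(f \circ \mathsf{IP}) \geq (1-\mathbb{H}_\mathsf{bin}(\epsilon))\,n(b-1)$ and $\mathsf{Q}^{*,\rightarrow,\epsilon}_{\mathrm{cc}}(f \circ \mathsf{IP}) \geq (1-\mathbb{H}_\mathsf{bin}(\epsilon))\,n(b-1)/2$.
   Context: $\mathsf{IP}(x_1,\dots,x_b,y_1,\dots,y_b)=\oplus_{i\in[b]}(x_i\wedge y_i)$. The composed function $f\circ\mathsf{IP}$ is the two-party function in which Alice holds $x=(x_1,\dots,x_n)$ and Bob holds $y=(y_1,\dots,y_n)$ with $x_i,y_i\in\{0,1\}^b$, and $(f\circ\mathsf{IP})(x,y)=f(\mathsf{IP}(x_1,y_1),\dots,\mathsf{IP}(x_n,y_n))$. $\mathsf{Q}^{\rightarrow,\epsilon}_{\mathrm{cc}}(F)$ is the minimum cost (number of qubits of Alice's message) of a one-way quantum protocol (Alice sends a quantum message to Bob, who performs a projective measurement and outputs its outcome) that outputs $F(x,y)$ with probability at least $1-\epsilon$ on every input; $\mathsf{Q}^{*,\rightarrow,\epsilon}_{\mathrm{cc}}(F)$ is the same when Alice and Bob may additionally share an arbitrary input-independent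 entangled state for free. $\mathbb{H}_\mathsf{bin}(p)=p\log\frac1p+(1-p)\log\frac1{1-p}$ is the binary entropy; logarithms are base 2. *)

(* Defs.v *)
From HB Require Import structures.
From mathcomp Require Import all_boot all_order all_algebra.
From mathcomp Require Import complex.
From mathcomp Require mxtens.
From mathcomp Require Import reals exp.

Set Implicit Arguments.
Unset Strict Implicit.
Unset Printing Implicit Defensive.

Import Order.TTheory GRing.Theory Num.Theory.
Local Open Scope ring_scope.

Definition IP (b : nat) (x y : {ffun 'I_b -> bool}) : bool :=
  \big[addb/false]_(i < b) (x i && y i).

Definition IPinput (n b : nat) := {ffun 'I_n -> {ffun 'I_b -> bool}}.

Definition composeIP (n b : nat) (f : {ffun 'I_n -> bool} -> bool)
  (x y : IPinput n b) : bool :=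
  f [ffun i => IP (x i) (y i)].

Definition flip_at (n : nat) (i : 'I_n) (z : {ffun 'I_n -> bool}) : {ffun 'I_n -> bool} :=
  [ffun j => if j == i then ~~ z j else z j].

Definition depends_on_all (n : nat) (f : {ffun 'I_n -> bool} -> bool) : Prop :=
  forall i : 'I_n, exists z, f z != f (flip_at i z).

Definition log2 {R : realType} (x : R) : R := ln x / ln 2.

Definition Hbin {R : realType} (p : R) : R :=
  p * log2 (1 / p) + (1 - p) * log2 (1 / (1 - p)).

Section Quantum.
Variable R : realType.
Local Notation C := R[i].

Definition hadj (m n : nat) (A : 'M[C]_(m, n)) : 'M[C]_(n, m) :=
  (map_mx Num.conj A)^T.

Definition hermitian (n : nat) (A : 'M[C]_n) : Prop := hadj A = A.

Definition psd (n : nat) (A : 'M[C]_n) : Prop :=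
  forall v : 'cV[C]_n, 0 <= (hadj v *m A *m v) 0 0.

Definition density (n : nat) (rho : 'M[C]_n) : Prop :=
  [/\ hermitian rho, psd rho & \tr rho = 1].

Definition projector (n : nat) (P : 'M[C]_n) : Prop :=
  hermitian P /\ P *m P = P.

Definition kraus_channel (K dout din : nat) (Ks : 'I_K -> 'M[C]_(dout, din)) : Prop :=
  \sum_(k < K) hadj (Ks k) *m Ks k = 1%:M.

Definition apply_left (K dout din dB : nat) (Ks : 'I_K -> 'M[C]_(dout, din))
  (sigma : 'M[C]_(din * dB)) : 'M[C]_(dout * dB) :=
  \sum_(k < K) (mxtens.tensmx (Ks k) (1%:M : 'M[C]_dB)) *m sigma
               *m hadj (mxtens.tensmx (Ks k) (1%:M : 'M[C]_dB)).

Definition prob_out (d : nat) (P rho : 'M[C]_d) (c : bool) : C :=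
  if c then \tr (P *m rho) else \tr ((1 - P) *m rho).

(* There is a one-way protocol of cost q (Alice sends q qubits) computing F with
   error at most eps on every input.  Alice and Bob start with a shared
   input-independent state sigma on A (x) B (dims dA, dB).  Alice applies a
   quantum channel depending on x mapping her register A to the 2^q-dimensional
   message register M, which she sends.  Bob performs a projective measurement,
   depending on y, on M (x) B and outputs the outcome.
   Without entanglement (entangled = false) Alice's share is trivial (dA = 1),
   i.e. sigma is just Bob's private workspace state. *)
Definition one_way_feasible (entangled : bool) (X Y : finType)
  (F : X -> Y -> bool) (eps : R) (q : nat) : Prop :=
  exists (dA dB : nat) (sigma : 'M[C]_(dA * dB)),
    [/\ density sigma, (~~ entangled -> dA = 1%N) &
    exists (K : nat) (Ks : X -> 'I_K -> 'M[C]_(2 ^ q, dA))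
           (P : Y -> 'M[C]_(2 ^ q * dB)),
      [/\ forall x, kraus_channel (Ks x),
          forall y, projector (P y) &
          forall x y, real_complex R (1 - eps)
                      <= prob_out (P y) (apply_left (Ks x) sigma) (F x y)]].

End Quantum.

(* Main.v *)
(* Fix x_i to have first bit 1 and let the other b - 1 bits be free. Querying the
   first bit forces any desired value of IP(x_j, y_j), so a sensitive input of f
   turns the protocol into a random access code for m = n(b - 1) bits.

   For such a code let H_j = H_j^-1 = H_j^* be Bob's signed measurement of bit j,
   s_j(x) = +-1 the sign of that bit, and rho_x the state encoding x; every
   s_j(x) H_j has bias at least delta = 1 - 2 eps in rho_x. If rho_x <= tau for all
   x, compare moments of A_x = 1 + (t/N) sum_j s_j(x) H_j with N = 2^r:
     (1 + t m delta / N)^N <= tr(rho_x A_x^N) <= tr(tau A_x^N).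
   Averaging over x kills all words in the H_j except those with nonnegative
   scalar counterpart, hence E_x tr(tau A_x^N) <= tr(tau) (cosh t)^m. As N grows,
   exp(t m delta) <= tr(tau) (cosh t)^m, and tanh t = delta gives
   m (1 - H(eps)) <= log2 (tr tau).

   One may take tau = 1 (x) sigma, of trace 2^q, without entanglement, and
   tau = 2^q (1 (x) sigma_B), of trace 4^q, with entanglement. *)

Require Import Defs.
From HB Require Import structures.
From mathcomp Require Import all_boot all_order all_algebra.
From mathcomp Require Import ring lra.
From mathcomp Require Import mxtens.
From mathcomp Require Import complex reals sequences exp.

Set Implicit Arguments.
Unset Strict Implicit.
Unset Printing Implicit Defensive.

Import Order.TTheory GRing.Theory Num.Theory.
Local Open Scope ring_scope.

(** * Adjoints, real traces and moment inequalities for states *)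

Section MatrixAlgebra.
Local Open Scope complex_scope.
Variable R : realType.
Local Notation C := R[i].

(** Products of observables need not be Hermitian and can have complex expectations; the real part
    keeps every moment comparison in [R]. *)
Definition retr (n : nat) (M : 'M[C]_n) : R := complex.Re (\tr M).

Lemma ReD (x y : C) : complex.Re (x + y) = complex.Re x + complex.Re y.
Proof. by case: x; case: y. Qed.

Lemma ReN (x : C) : complex.Re (- x) = - complex.Re x.
Proof. by case: x. Qed.

Lemma Re_conj (x : C) : complex.Re (Num.conj x) = complex.Re x.
Proof. by case: x. Qed.

Lemma Re_mulr (a : R) (x : C) : complex.Re (a%:C * x) = a * complex.Re x.
Proof. by case: x => x1 x2 /=; rewrite mul0r subr0. Qed.

Lemma Re_ge0 (x : C) : 0 <= x -> 0 <= complex.Re x.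
Proof. by rewrite lecE => /andP[]. Qed.

Lemma conj_real (a : R) : Num.conj a%:C = a%:C.
Proof. by rewrite /Num.conj /= oppr0. Qed.

Lemma retrD n (A B : 'M[C]_n) : retr (A + B) = retr A + retr B.
Proof. by rewrite /retr mxtraceD ReD. Qed.

Lemma retrN n (A : 'M[C]_n) : retr (- A) = - retr A.
Proof. by rewrite /retr raddfN ReN. Qed.

Lemma retrB n (A B : 'M[C]_n) : retr (A - B) = retr A - retr B.
Proof. by rewrite retrD retrN. Qed.

Lemma retrZ n (a : R) (A : 'M[C]_n) : retr (a%:C *: A) = a * retr A.
Proof. by rewrite /retr mxtraceZ Re_mulr. Qed.

Lemma retr0 n : retr (0 : 'M[C]_n) = 0.
Proof. by rewrite /retr mxtrace0. Qed.

Lemma retr_sum n (I : finType) (F : I -> 'M[C]_n) :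
  retr (\sum_i F i) = \sum_i retr (F i).
Proof. by apply: (big_morph _ (@retrD n) (retr0 n)). Qed.

Lemma hadjM m n p (A : 'M[C]_(m, n)) (B : 'M[C]_(n, p)) :
  hadj (A *m B) = hadj B *m hadj A.
Proof. by rewrite /hadj map_mxM trmx_mul. Qed.

Lemma hadjK m n (A : 'M[C]_(m, n)) : hadj (hadj A) = A.
Proof. by apply/matrixP => i j; rewrite !mxE conjCK. Qed.

Lemma hadjD m n (A B : 'M[C]_(m, n)) : hadj (A + B) = hadj A + hadj B.
Proof. by apply/matrixP => i j; rewrite !mxE rmorphD. Qed.

Lemma hadjN m n (A : 'M[C]_(m, n)) : hadj (- A) = - hadj A.
Proof. by apply/matrixP => i j; rewrite !mxE rmorphN. Qed.

Lemma hadj0 m n : hadj (0 : 'M[C]_(m, n)) = 0.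
Proof. by apply/matrixP => i j; rewrite !mxE rmorph0. Qed.

Lemma hadjZ m n (a : C) (A : 'M[C]_(m, n)) : hadj (a *: A) = Num.conj a *: hadj A.
Proof. by apply/matrixP => i j; rewrite !mxE rmorphM. Qed.

Lemma hadj1 n : hadj (1%:M : 'M[C]_n) = 1%:M.
Proof. by apply/matrixP => i j; rewrite !mxE rmorph_nat eq_sym. Qed.

Lemma hadj_sum m n (I : finType) (F : I -> 'M[C]_(m, n)) :
  hadj (\sum_i F i) = \sum_i hadj (F i).
Proof. by apply: (big_morph _ (@hadjD m n) (hadj0 m n)). Qed.

Lemma mxtrace_hadj n (A : 'M[C]_n) : \tr (hadj A) = Num.conj (\tr A).
Proof. by rewrite /mxtrace rmorph_sum; apply: eq_bigr => i _; rewrite !mxE. Qed.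

(** By cyclicity the trace is the sum, over the columns of [B], of the quadratic form of [A]. *)
Lemma psd_tr_ge0 n p (A : 'M[C]_n) (B : 'M[C]_(n, p)) :
  psd A -> 0 <= \tr (A *m (B *m hadj B)).
Proof.
move=> psdA; rewrite mulmxA mxtrace_mulC mulmxA.
apply: sumr_ge0 => i _; have := psdA (col i B); congr (0 <= _).
have -> : hadj (col i B) = row i (hadj B) by apply/matrixP => k l; rewrite !mxE.
by rewrite -row_mul !mxE; apply: eq_bigr => k _; rewrite !mxE.
Qed.

Lemma psd_retr_ge0 n p (A : 'M[C]_n) (B : 'M[C]_(n, p)) :
  psd A -> 0 <= retr (A *m (B *m hadj B)).
Proof. by move=> psdA; apply/Re_ge0/psd_tr_ge0. Qed.

(** Expand [(1 - U) *m hadj (1 - U)] as [2 - U - hadj U] and pair it with [tau]; [U] and [hadj U]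
    contribute the same real part because [tau] is Hermitian. *)
Lemma retr_mul_unitary n (tau U : 'M[C]_n) :
  Defs.hermitian tau -> psd tau -> U *m hadj U = 1%:M ->
  retr (tau *m U) <= retr tau.
Proof.
move=> htau ptau unU; have := @psd_retr_ge0 n n tau (1%:M - U) ptau.
have e : retr (tau *m hadj U) = retr (tau *m U).
  by rewrite -[in LHS]htau -hadjM /retr mxtrace_hadj Re_conj mxtrace_mulC.
rewrite hadjD hadjN hadj1 mulmxBl mul1mx !mulmxBr unU !mulmx1 !retrB e; lra.
Qed.

(** Nonnegativity of a variance: pair [rho] with the square of [B] minus its mean [b]. *)
Lemma retr_sqr_ge n (rho B : 'M[C]_n) :
  density rho -> Defs.hermitian B -> retr (rho *m B) ^+ 2 <= retr (rho *m (B *m B)).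
Proof.
move=> [_ prho trho] hB; set b := retr _.
have := @psd_retr_ge0 n n rho (B - b%:C%:M) prho.
rewrite hadjD hadjN hB -scalemx1 hadjZ hadj1 conj_real.
have -> : (B - b%:C *: 1%:M) *m (B - b%:C *: 1%:M)
        = B *m B - b%:C *: B - (b%:C *: B - b%:C *: (b%:C *: 1%:M)).
  by rewrite mulmxBl !mulmxBr -!scalemxAl -!scalemxAr !(mul1mx, mulmx1).
rewrite !mulmxBr !retrB -!scalemxAr !retrZ mulmx1 -/b.
have -> : retr rho = 1 by rewrite /retr trho.
rewrite mulr1 subrr subr0 expr2 => h; lra.
Qed.

Lemma psd_sqr_le n (rho tau B : 'M[C]_n) :
  psd (tau - rho) -> Defs.hermitian B -> retr (rho *m (B *m B)) <= retr (tau *m (B *m B)).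
Proof.
move=> ptr hB; have := @psd_retr_ge0 n n _ B ptr.
by rewrite hB mulmxBl retrB subr_ge0.
Qed.

Lemma hermitian_exp n (B : 'M[C]_n) k : Defs.hermitian B -> Defs.hermitian (B ^+ k).
Proof.
move=> hB; elim: k => [|k IH]; first by rewrite /Defs.hermitian expr0 hadj1.
by rewrite /Defs.hermitian {1}exprS hadjM IH hB exprSr.
Qed.

(** The variance inequality is iterated by repeated squaring, hence exponents that are powers of
    two. *)
Lemma retr_exp_ge n r (rho B : 'M[C]_n) :
  density rho -> Defs.hermitian B -> 0 <= retr (rho *m B) ->
  retr (rho *m B) ^+ (2 ^ r) <= retr (rho *m B ^+ (2 ^ r)).
Proof.
move=> drho hB B0; elim: r => [|r IH]; first by rewrite expn0 !expr1.
rewrite expnSr !exprM.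
apply: le_trans (_ : retr (rho *m B ^+ (2 ^ r)) ^+ 2 <= _).
  by rewrite ler_pXn2r ?nnegrE ?exprn_ge0 // (le_trans _ IH) ?exprn_ge0.
by rewrite [_ ^+ 2]expr2; apply: retr_sqr_ge => //; apply: hermitian_exp.
Qed.

End MatrixAlgebra.

(** * Compound growth versus the exponential *)

Section ExponentialBounds.
Variable R : realType.

(** Since [1 + y / N] is at least [expR (y / (N + y))], the compound power is at least
    [expR (N * y / (N + y))], which exceeds [K] for large [N] if [ln K < y]. *)
Lemma le_ln_of_compound (y K : R) (r0 : nat) :
  0 <= y -> 0 < K ->
  (forall r, (r0 <= r)%N -> (1 + y / (2 ^ r)%:R) ^+ (2 ^ r) <= K) -> y <= ln K.
Proof.
move=> y0 K0 h; set L := ln K; rewrite leNgt; apply/negP => yL.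
have yL' : 0 < y - L by rewrite subr_gt0.
(* The inequality on [N = 2 ^ r] rearranges to [L < N * y / (N + y)], the contradiction sought. *)
have [r r0r Nlarge] : exists2 r, (r0 <= r)%N & L * y < (2 ^ r)%:R * (y - L).
  exists (maxn r0 (Num.bound `|L * y / (y - L)|)); first exact: leq_maxl.
  rewrite -ltr_pdivrMr //.
  apply: le_lt_trans (ler_norm _) _; apply: lt_le_trans (archi_boundP _) _ => //.
  by rewrite ler_nat; apply: leq_trans (leq_maxr _ _) (ltnW (ltn_expl _ _)).
have N0 : 0 < (2 ^ r)%:R :> R by rewrite ltr0n expn_gt0.
have := h r r0r; move: (2 ^ r)%N N0 Nlarge => N N0 Nlarge hK.
have D0 : 0 < N%:R + y by rewrite ltr_wpDr.
have step : expR (y / (N%:R + y)) <= 1 + y / N%:R.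
  have := expR_ge1Dx (- (y / (N%:R + y))); rewrite expRN.
  have -> : 1 - y / (N%:R + y) = (1 + y / N%:R)^-1.
    by field; rewrite !lt0r_neq0.
  by rewrite lef_pV2 // posrE ?expR_gt0 // ltr_pwDl // divr_ge0 // ltW.
have : expR (y / (N%:R + y) * N%:R) <= K.
  rewrite expRM_natr; apply: le_trans hK; apply: lerXn2r => //.
    by rewrite nnegrE expR_ge0.
  by rewrite nnegrE addr_ge0 // divr_ge0 // ltW.
rewrite -[K]lnK ?posrE // -/L ler_expR mulrAC ler_pdivrMr // leNgt => /negP; apply.
by rewrite mulrDr -ltrBrDl; move: Nlarge; rewrite mulrBr ![N%:R * _]mulrC.
Qed.

Lemma compound_le_expR (t : R) (N : nat) :
  (0 < N)%N -> 0 <= 1 + t / N%:R -> (1 + t / N%:R) ^+ N <= expR t.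
Proof.
move=> N0 t0; have -> : expR t = expR (t / N%:R) ^+ N.
  by rewrite -expRM_natr divfK // pnatr_eq0 -lt0n.
by rewrite ler_pXn2r ?nnegrE ?expR_ge0 // expR_ge1Dx.
Qed.

End ExponentialBounds.

(** * Moment bound for random access codes *)

Section RandomAccessCode.
Local Open Scope complex_scope.
Variables (R : realType) (J : finType) (d : nat).
Local Notation C := R[i].
Local Notation X := {ffun J -> bool}.
Implicit Types (x : X) (j : J) (S : seq J).

Definition sgn (x : X) (j : J) : R := (-1) ^+ x j.

(** The sum factors over coordinates, and [j] contributes [1 + (-1) ^ k] with [k] its multiplicity
    in [S]: 0 or 2. *)
Lemma sum_character_ge0 S : 0 <= \sum_x \prod_(j <- S) sgn x j.
Proof.
have e x : \prod_(j <- S) sgn x j = \prod_j (-1) ^+ (x j * count_mem j S).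
  elim: S => [|i S IH]; first by rewrite big_nil big1 // => j _; rewrite muln0.
  rewrite big_cons IH (bigD1 i) //= [RHS](bigD1 i) //= eqxx mulrA mulnDr muln1 exprD.
  by congr (_ * _); apply: eq_bigr => j /negPf; rewrite eq_sym => ->.
under eq_bigr do rewrite e.
rewrite -(bigA_distr_bigA (fun j (c : bool) => (-1) ^+ (c * count_mem j S))).
apply: prodr_ge0 => j _; rewrite big_bool /= mul0n mul1n expr0 -signr_odd.
by case: odd; rewrite /= ?expr0 ?expr1 ?addNr // addr_ge0.
Qed.

Lemma sum_sgn_expR (t : R) :
  \sum_x expR (t * \sum_j sgn x j) = (expR t + expR (- t)) ^+ #|J|.
Proof.
under eq_bigr do rewrite mulr_sumr expR_sum.
rewrite -(bigA_distr_bigA (fun j (c : bool) => expR (t * (-1) ^+ c))).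
under eq_bigr do rewrite big_bool /= expr0 expr1 mulr1 mulrN1 addrC.
by rewrite prodr_const.
Qed.

Variables (H : J -> 'M[C]_d) (tau : 'M[C]_d).
Hypothesis (H_herm : forall j, Defs.hermitian (H j)).
Hypothesis (H_sqr : forall j, H j *m H j = 1%:M).
Hypothesis (tau_herm : Defs.hermitian tau) (tau_psd : psd tau).

Definition biased (c : R) x : 'M[C]_d := 1 + \sum_j (c * sgn x j)%:C *: H j.

Lemma biased_hermitian c x : Defs.hermitian (biased c x).
Proof.
rewrite /Defs.hermitian hadjD hadj1 hadj_sum; congr (_ + _).
by apply: eq_bigr => j _; rewrite hadjZ conj_real H_herm.
Qed.

(* Expanding the power into words in the [H j], every word is unitary, and
   averaging against the character of [S] gives it the same nonnegative weight
   as the corresponding monomial on the right. *)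
Lemma sum_retr_biased_le (c : R) N S (U : 'M[C]_d) :
  0 <= c -> U *m hadj U = 1%:M ->
  \sum_x (\prod_(j <- S) sgn x j) * retr (tau *m (U *m biased c x ^+ N))
  <= retr tau * \sum_x (\prod_(j <- S) sgn x j) * (1 + c * \sum_j sgn x j) ^+ N.
Proof.
move=> c0; elim: N S U => [|N IH] S U unU.
  under eq_bigr do rewrite expr0 mulmx1; under [X in _ * X]eq_bigr do rewrite expr0 mulr1.
  rewrite -mulr_suml mulrC ler_wpM2r ?sum_character_ge0 //.
  exact: retr_mul_unitary.
(* Peel off the leftmost factor: its unit keeps [S] and [U], while its [H i] term adds [i] to [S]
   and multiplies [U] by [H i]. [eR] is the same recurrence for the scalars, with the same
   nonnegative coefficients. *)
have eL x : (\prod_(j <- S) sgn x j) * retr (tau *m (U *m biased c x ^+ N.+1))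
  = (\prod_(j <- S) sgn x j) * retr (tau *m (U *m biased c x ^+ N)) +
    \sum_i c * ((\prod_(j <- i :: S) sgn x j)
                * retr (tau *m ((U *m H i) *m biased c x ^+ N))).
  rewrite exprS {1}/biased mulrDl mul1r mulmxDr mulmxDr retrD mulrDr; congr (_ + _).
  rewrite mulr_suml !mulmx_sumr retr_sum mulr_sumr; apply: eq_bigr => i _.
  rewrite -mulmxE -scalemxAl -!scalemxAr retrZ big_cons -mulmxA; ring.
have eR x : (\prod_(j <- S) sgn x j) * (1 + c * \sum_j sgn x j) ^+ N.+1
  = (\prod_(j <- S) sgn x j) * (1 + c * \sum_j sgn x j) ^+ N +
    \sum_i c * ((\prod_(j <- i :: S) sgn x j) * (1 + c * \sum_j sgn x j) ^+ N).
  rewrite exprS mulrDl mul1r mulrDr; congr (_ + _).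
  rewrite mulr_sumr mulr_suml mulr_sumr; apply: eq_bigr => i _.
  rewrite big_cons; ring.
under eq_bigr do rewrite eL; under [X in _ * X]eq_bigr do rewrite eR.
rewrite !big_split /= mulrDr; apply: lerD; first exact: IH.
rewrite exchange_big [X in _ * X]exchange_big mulr_sumr /=.
apply: ler_sum => i _; rewrite -!mulr_sumr mulrCA ler_wpM2l //.
by apply: IH; rewrite hadjM H_herm mulmxA -[_ *m H i *m H i]mulmxA H_sqr mulmx1.
Qed.

Variables (rho : X -> 'M[C]_d) (delta : R).
Hypothesis (rho_density : forall x, density (rho x)).
Hypothesis (rho_le : forall x, psd (tau - rho x)).
Hypothesis (delta_ge0 : 0 <= delta).
Hypothesis (rho_bias : forall x j, delta <= sgn x j * retr (rho x *m H j)).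

Lemma retr_biased_ge c x :
  0 <= c -> 1 + c * (#|J|%:R * delta) <= retr (rho x *m biased c x).
Proof.
move=> c0; rewrite mulmxDr mulmx1 retrD mulmx_sumr retr_sum.
have -> : retr (rho x) = 1 by have [_ _] := rho_density x; rewrite /retr => ->.
rewrite lerD2l mulr_natl mulrnAr -sumr_const; apply: ler_sum => j _.
by rewrite -scalemxAr retrZ -mulrA ler_wpM2l.
Qed.

(* Compares the moments of order [2 ^ r] of [biased (t / 2 ^ r) x] in the states
   [rho x] and [tau], and lets [r] tend to infinity. *)
Lemma rac_bound (t : R) : 0 <= t -> 0 < retr tau ->
  t * (#|J|%:R * delta)
  <= ln (retr tau * (expR t + expR (- t)) ^+ #|J| / 2 ^+ #|J|).
Proof.
move=> t0 T0.
(* The threshold gives [t * #|J| <= N], so that the scalar bases [1 + c * \sum_j sgn x j] are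
   nonnegative. The successor makes [N] even, so that the [N]-th power of [biased] is the square of
   a Hermitian matrix. *)
apply: (@le_ln_of_compound _ _ _ (Num.bound (t * #|J|%:R)).+1).
- by rewrite !mulr_ge0.
- by rewrite divr_gt0 ?mulr_gt0 ?exprn_gt0 // addr_gt0 ?expR_gt0.
move=> [//|r] ltr; set N := (2 ^ r.+1)%N; set c := t / N%:R.
have N0 : (0 < N)%N by rewrite expn_gt0.
have NR0 : 0 < N%:R :> R by rewrite ltr0n.
have c0 : 0 <= c by rewrite divr_ge0 // ltW.
have Nlarge : t * #|J|%:R <= N%:R.
  apply: ltW; apply: lt_le_trans (archi_boundP _) _; first by rewrite mulr_ge0.
  by rewrite ler_nat (leq_trans (ltnW ltr)) //; apply: ltnW; apply: ltn_expl.
rewrite ler_pdivlMr ?exprn_gt0 // mulrAC -/c mulrC.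
have -> : 2 ^+ #|J| * (1 + c * (#|J|%:R * delta)) ^+ N
   = \sum_(x : X) (1 + c * (#|J|%:R * delta)) ^+ N.
  by rewrite sumr_const card_ffun card_bool -[RHS]mulr_natl natrX.
apply: le_trans (_ : \sum_x retr (tau *m (1%:M *m biased c x ^+ N)) <= _).
  apply: ler_sum => x _; have B1 := retr_biased_ge x c0.
  have y0 : 0 <= 1 + c * (#|J|%:R * delta).
    by rewrite addr_ge0 // (mulr_ge0 c0) // mulr_ge0 // ler0n.
  apply: le_trans (_ : retr (rho x *m biased c x) ^+ N <= _).
    by rewrite ler_pXn2r ?nnegrE // (le_trans y0).
  apply: le_trans (retr_exp_ge r.+1 _ _ _) _ => //.
  - exact: biased_hermitian.
  - exact: le_trans B1.
  rewrite mul1mx /N expnSr muln2 -addnn exprD; apply: psd_sqr_le => //.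
  by apply: hermitian_exp; apply: biased_hermitian.
(* The empty character and the trivial word give the plain sum over [x]. *)
have := @sum_retr_biased_le c N [::] 1%:M c0.
rewrite hadj1 mulmx1 => /(_ erefl); under eq_bigr do rewrite big_nil mul1r.
move=> /le_trans; apply; rewrite (ler_wpM2l (ltW T0)) // -sum_sgn_expR.
apply: ler_sum => x _; rewrite big_nil mul1r.
rewrite /c mulrAC; apply: compound_le_expR => //.
have : - (#|J|%:R : R) <= \sum_j sgn x j.
  rewrite -sumr_const -sumrN; apply: ler_sum => j _.
  by rewrite /sgn; case: (x j); rewrite ?expr1 // expr0; lra.
move=> /(ler_wpM2l t0) hs.
rewrite -[X in X + _](divff (lt0r_neq0 NR0)) -mulrDl (divr_ge0 _ (ltW NR0)) //.
by rewrite -[X in X <= _](subrr (t * #|J|%:R)) lerD // -mulrN.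
Qed.

End RandomAccessCode.

(** * Quadratic forms and domination of the transmitted states *)

Section LoewnerOrder.
Local Open Scope complex_scope.
Variable R : realType.
Local Notation C := R[i].

Definition sesqui n (A : 'M[C]_n) (u v : 'cV[C]_n) : C := (hadj u *m A *m v) 0 0.

Lemma sesquiDl n (A : 'M[C]_n) u v w : sesqui A (u + v) w = sesqui A u w + sesqui A v w.
Proof. by rewrite /sesqui hadjD !mulmxDl mxE. Qed.

Lemma sesquiDr n (A : 'M[C]_n) u v w : sesqui A u (v + w) = sesqui A u v + sesqui A u w.
Proof. by rewrite /sesqui mulmxDr mxE. Qed.

Lemma sesquiZl n (A : 'M[C]_n) a u v : sesqui A (a *: u) v = Num.conj a * sesqui A u v.
Proof. by rewrite /sesqui hadjZ -!scalemxAl mxE. Qed.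

Lemma sesquiZr n (A : 'M[C]_n) a u v : sesqui A u (a *: v) = a * sesqui A u v.
Proof. by rewrite /sesqui -!scalemxAr mxE. Qed.

Lemma sesqui_suml n (A : 'M[C]_n) (I : finType) (u : I -> 'cV[C]_n) v :
  sesqui A (\sum_i u i) v = \sum_i sesqui A (u i) v.
Proof. by rewrite /sesqui hadj_sum !mulmx_suml summxE. Qed.

Lemma sesqui_sumr n (A : 'M[C]_n) (I : finType) u (v : I -> 'cV[C]_n) :
  sesqui A u (\sum_i v i) = \sum_i sesqui A u (v i).
Proof. by rewrite /sesqui mulmx_sumr summxE. Qed.

Lemma sesqui_summx n (I : finType) (A : I -> 'M[C]_n) u v :
  sesqui (\sum_i A i) u v = \sum_i sesqui (A i) u v.
Proof. by rewrite /sesqui mulmx_sumr mulmx_suml summxE. Qed.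

Lemma sesquiBmx n (A B : 'M[C]_n) u v : sesqui (A - B) u v = sesqui A u v - sesqui B u v.
Proof. by rewrite /sesqui mulmxBr mulmxBl mxE [X in _ + X]mxE. Qed.

Lemma sesquiZmx n a (A : 'M[C]_n) u v : sesqui (a *: A) u v = a * sesqui A u v.
Proof. by rewrite /sesqui -scalemxAr -scalemxAl mxE. Qed.

Lemma sesqui_conj m n (B : 'M[C]_(m, n)) (A : 'M[C]_n) u v :
  sesqui (B *m A *m hadj B) u v = sesqui A (hadj B *m u) (hadj B *m v).
Proof. by rewrite /sesqui hadjM hadjK !mulmxA. Qed.

Lemma psd_conj m n (B : 'M[C]_(m, n)) (A : 'M[C]_n) : psd A -> psd (B *m A *m hadj B).
Proof. by move=> pA v; rewrite -[X in 0 <= X]/(sesqui _ v v) sesqui_conj; apply: pA. Qed.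

Lemma psd_sum n (I : finType) (A : I -> 'M[C]_n) :
  (forall i, psd (A i)) -> psd (\sum_i A i).
Proof.
move=> pA v; rewrite -[X in 0 <= X]/(sesqui _ v v) sesqui_summx.
by apply: sumr_ge0 => i _; apply: pA.
Qed.

Lemma hermitian_conj m n (B : 'M[C]_(m, n)) (A : 'M[C]_n) :
  Defs.hermitian A -> Defs.hermitian (B *m A *m hadj B).
Proof. by move=> hA; rewrite /Defs.hermitian !hadjM hadjK hA mulmxA. Qed.

Lemma hermitian_sum n (I : finType) (A : I -> 'M[C]_n) :
  (forall i, Defs.hermitian (A i)) -> Defs.hermitian (\sum_i A i).
Proof. by move=> hA; rewrite /Defs.hermitian hadj_sum; apply: eq_bigr => i _; apply: hA. Qed.

Lemma sesqui_cauchy_schwarz n (A : 'M[C]_n) (I : finType) (c : I -> C)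
    (u : I -> 'cV[C]_n) : psd A ->
  sesqui A (\sum_i c i *: u i) (\sum_i c i *: u i)
  <= (\sum_i Num.conj (c i) * c i) * \sum_i sesqui A (u i) (u i).
Proof.
move=> pA; rewrite -subr_ge0.
pose w i j := Num.conj (c j) *: u i - Num.conj (c i) *: u j.
(* Lagrange's identity *)
have : 0 <= \sum_i \sum_j sesqui A (w i j) (w i j).
  by apply: sumr_ge0 => i _; apply: sumr_ge0 => j _; apply: pA.
suff -> : \sum_i \sum_j sesqui A (w i j) (w i j) =
   2 * ((\sum_i Num.conj (c i) * c i) * (\sum_i sesqui A (u i) (u i)) -
   sesqui A (\sum_i c i *: u i) (\sum_i c i *: u i)).
  by rewrite pmulr_rge0.
(* The form at [w i j] is [F i j + F j i]; summing over all pairs yields the factor 2. *)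
pose F i j := Num.conj (c j) * c j * sesqui A (u i) (u i)
              - Num.conj (c i) * c j * sesqui A (u i) (u j).
have eF : \sum_i \sum_j F i j =
   (\sum_i Num.conj (c i) * c i) * (\sum_i sesqui A (u i) (u i)) -
   sesqui A (\sum_i c i *: u i) (\sum_i c i *: u i).
  rewrite sesqui_suml mulrC mulr_suml -sumrB; apply: eq_bigr => i _.
  rewrite sesqui_sumr mulr_sumr -sumrB; apply: eq_bigr => j _.
  rewrite sesquiZl sesquiZr /F; ring.
rewrite -eF mulr2n mulrDl mul1r [X in _ + X]exchange_big -big_split /=.
apply: eq_bigr => i _; rewrite -big_split /=; apply: eq_bigr => j _.
rewrite /w -!scaleNr !(sesquiDl, sesquiDr, sesquiZl, sesquiZr) !rmorphN /= !conjCK /F.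
ring.
Qed.

(** * Block decomposition, partial trace and channels on one tensor factor *)

Section Tensor.
Variable dB : nat.

Lemma hadj_tensmx m n p q (A : 'M[C]_(m, n)) (B : 'M[C]_(p, q)) :
  hadj (tensmx A B) = tensmx (hadj A) (hadj B).
Proof. by rewrite /hadj map_mxT trmx_tens. Qed.

Lemma tensmxZl m n p q a (A : 'M[C]_(m, n)) (B : 'M[C]_(p, q)) :
  tensmx (a *: A) B = a *: tensmx A B.
Proof. by apply/matrixP => i j; rewrite !mxE mulrA. Qed.

Lemma tensmx_suml m n p q (I : finType) (A : I -> 'M[C]_(m, n)) (B : 'M[C]_(p, q)) :
  tensmx (\sum_i A i) B = \sum_i tensmx (A i) B.
Proof.
apply/matrixP => i j; rewrite mxE !summxE mulr_suml.
by apply: eq_bigr => k _; rewrite mxE.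
Qed.

Lemma tensmx11 n : tensmx (1%:M : 'M[C]_n) (1%:M : 'M[C]_dB) = 1%:M.
Proof.
apply/matrixP => i j; case: (mxtens_indexP i) => a k; case: (mxtens_indexP j) => a' k'.
rewrite tensmxE !mxE (can_eq (@mxtens_indexK _ _)) xpair_eqE.
by case: eqP; case: eqP; rewrite /= ?mulr1 ?mulr0 // mul0r.
Qed.

(** The isometry of Bob's space onto the block of basis vector [a]. The source dimension stays
    [1 * dB] so that this is literally a [tensmx]. *)
Definition slot n (a : 'I_n) : 'M[C]_(n * dB, 1 * dB) :=
  tensmx (delta_mx a 0) 1%:M.

Lemma slot_orthonormal n (a b : 'I_n) :
  hadj (slot a) *m slot b = (a == b)%:R *: 1%:M.
Proof.
rewrite /slot hadj_tensmx tensmx_mul hadj1 mulmx1 -tensmx11 -tensmxZl; congr tensmx.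
apply/matrixP => i j; rewrite !ord1 !mxE eqxx mulr1 (bigD1 a) //= big1 ?addr0.
  by rewrite !mxE !eqxx /= rmorph1 mul1r andbT.
by move=> k /negPf ka; rewrite !mxE ka rmorph0 mul0r.
Qed.

Lemma slot_complete n : \sum_(a < n) slot a *m hadj (slot a) = 1%:M.
Proof.
rewrite -tensmx11.
have -> : (1%:M : 'M[C]_n) = \sum_(a < n) delta_mx a (0 : 'I_1) *m hadj (delta_mx a 0).
  apply/matrixP => i j; rewrite !mxE summxE (bigD1 i) //= big1 ?addr0.
    by rewrite !mxE big_ord1 !mxE !eqxx mul1r andbT rmorph_nat eq_sym.
  by move=> k /negPf ki; rewrite !mxE big_ord1 !mxE eq_sym ki mul0r.
rewrite tensmx_suml; apply: eq_bigr => a _.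
by rewrite /slot hadj_tensmx hadj1 tensmx_mul mulmx1.
Qed.

Lemma tensmx_slot m n (K : 'M[C]_(m, n)) (i : 'I_n) :
  tensmx K 1%:M *m slot i = \sum_(a < m) K a i *: slot a.
Proof.
rewrite /slot tensmx_mul mulmx1.
under [RHS]eq_bigr do rewrite -tensmxZl.
rewrite -tensmx_suml; congr tensmx; apply/matrixP => a j; rewrite ord1 summxE !mxE.
rewrite (bigD1 i) //= big1 ?addr0 => [|k /negPf ki]; last by rewrite !mxE ki mulr0.
rewrite (bigD1 a) //= big1 ?addr0 => [|k /negPf ki]; first by rewrite !mxE !eqxx.
by rewrite !mxE eq_sym ki mulr0.
Qed.

Lemma hadj_slot_tensmx m n (K : 'M[C]_(m, n)) (a : 'I_m) :
  hadj (slot a) *m tensmx K 1%:M = \sum_(i < n) K a i *: hadj (slot i).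
Proof.
rewrite -[LHS]hadjK hadjM hadjK hadj_tensmx hadj1 tensmx_slot hadj_sum.
by apply: eq_bigr => i _; rewrite hadjZ !mxE conjCK.
Qed.

Definition ptrace n (A : 'M[C]_(n * dB)) : 'M[C]_(1 * dB) :=
  \sum_(a < n) hadj (slot a) *m A *m slot a.

(** This is the identity of size [n] tensored with [A], written blockwise so that its quadratic form
    splits over the blocks of a vector. *)
Definition ampliate n (A : 'M[C]_(1 * dB)) : 'M[C]_(n * dB) :=
  \sum_(a < n) slot a *m A *m hadj (slot a).

Lemma mxtrace_ptrace n (A : 'M[C]_(n * dB)) : \tr (ptrace A) = \tr A.
Proof.
rewrite /ptrace raddf_sum /=.
under eq_bigr do rewrite mxtrace_mulC mulmxA.
by rewrite -raddf_sum -mulmx_suml slot_complete mul1mx.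
Qed.

Lemma mxtrace_ampliate n (A : 'M[C]_(1 * dB)) : \tr (ampliate n A) = n%:R * \tr A.
Proof.
rewrite /ampliate raddf_sum /=.
under eq_bigr do rewrite mxtrace_mulC mulmxA slot_orthonormal eqxx scale1r mul1mx.
by rewrite sumr_const card_ord mulr_natl.
Qed.

Lemma sesqui_ampliate n (A : 'M[C]_(1 * dB)) u v :
  sesqui (ampliate n A) u v = \sum_(a < n) sesqui A (hadj (slot a) *m u) (hadj (slot a) *m v).
Proof. by rewrite sesqui_summx; under eq_bigr do rewrite sesqui_conj. Qed.

Lemma psd_ampliate n (A : 'M[C]_(1 * dB)) : psd A -> psd (ampliate n A).
Proof. by move=> pA; apply: psd_sum => a; apply: psd_conj. Qed.

Lemma hermitian_ampliate n (A : 'M[C]_(1 * dB)) :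
  Defs.hermitian A -> Defs.hermitian (ampliate n A).
Proof. by move=> hA; apply: hermitian_sum => a; apply: hermitian_conj. Qed.

Lemma psd_ptrace n (A : 'M[C]_(n * dB)) : psd A -> psd (ptrace A).
Proof.
by move=> pA; apply: psd_sum => a; rewrite -{2}[slot a]hadjK; apply: psd_conj.
Qed.

Lemma hermitian_ptrace n (A : 'M[C]_(n * dB)) :
  Defs.hermitian A -> Defs.hermitian (ptrace A).
Proof.
by move=> hA; apply: hermitian_sum => a; rewrite -{2}[slot a]hadjK; apply: hermitian_conj.
Qed.

(** Split [v] into its [n] blocks: Cauchy-Schwarz with unit coefficients costs the factor [n], and
    the form of [A] at block [a] is one of the nonnegative terms of the form of [ptrace A] there. *)
Lemma psd_ampliate_ptrace n (A : 'M[C]_(n * dB)) :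
  psd A -> psd (n%:R *: ampliate n (ptrace A) - A).
Proof.
move=> pA v.
rewrite -[X in 0 <= X]/(sesqui _ v v) sesquiBmx sesquiZmx.
rewrite subr_ge0 sesqui_ampliate.
pose vv a := hadj (@slot n a) *m v.
have {1 2}-> : v = \sum_(a < n) 1 *: (slot a *m vv a).
  under eq_bigr do rewrite scale1r mulmxA.
  by rewrite -mulmx_suml slot_complete mul1mx.
apply: le_trans (sesqui_cauchy_schwarz _ _ pA) _.
rewrite rmorph1 mul1r sumr_const card_ord ler_wpM2l ?ler0n //.
apply: ler_sum => a _; rewrite sesqui_summx (bigD1 a) //=.
have e b w : sesqui (hadj (slot b) *m A *m slot b) w w = sesqui A (slot b *m w) (slot b *m w).
  by rewrite -[X in _ *m X]hadjK sesqui_conj hadjK.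
rewrite e lerDl; apply: sumr_ge0 => b _; rewrite e; exact: pA.
Qed.

Variables (dout din nK : nat) (Ks : 'I_nK -> 'M[C]_(dout, din)).
Hypothesis Ks_channel : kraus_channel Ks.

Lemma psd_apply_left (A : 'M[C]_(din * dB)) : psd A -> psd (apply_left Ks A).
Proof. by move=> pA; apply: psd_sum => k; apply: psd_conj. Qed.

Lemma hermitian_apply_left (A : 'M[C]_(din * dB)) :
  Defs.hermitian A -> Defs.hermitian (apply_left Ks A).
Proof. by move=> pA; apply: hermitian_sum => k; apply: hermitian_conj. Qed.

(** No signalling: Bob's marginal ignores Alice's channel, so a dominating matrix built from it is
    the same for all her inputs. *)
Lemma ptrace_apply_left (A : 'M[C]_(din * dB)) : ptrace (apply_left Ks A) = ptrace A.
Proof.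
pose G i j := hadj (slot i) *m A *m slot j.
have e a k : hadj (slot a) *m (tensmx (Ks k) 1%:M *m A *m hadj (tensmx (Ks k) 1%:M))
    *m slot a = \sum_(i < din) \sum_(j < din) (Num.conj (Ks k a j) * Ks k a i) *: G i j.
  rewrite !mulmxA hadj_slot_tensmx -mulmxA hadj_tensmx hadj1 tensmx_slot.
  rewrite !mulmx_suml; apply: eq_bigr => i _; rewrite mulmx_sumr; apply: eq_bigr => j _.
  by rewrite -!scalemxAl -!scalemxAr scalerA mulrC !mxE.
rewrite {1}/ptrace /apply_left.
under eq_bigr do rewrite mulmx_sumr mulmx_suml.
under eq_bigr do under eq_bigr do rewrite e.
rewrite exchange_big /=; under eq_bigr do rewrite exchange_big /=.
rewrite exchange_big /=; apply: eq_bigr => i _.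
under eq_bigr do rewrite exchange_big /=.
rewrite exchange_big /= (bigD1 i) //= [X in _ + X]big1 ?addr0 => [|j /negPf ji].
all: under eq_bigr do rewrite -scaler_suml; rewrite -scaler_suml.
(* The coefficient of block [G i j] is entry [(j, i)] of the Kraus identity, so only diagonal blocks
   survive. *)
all: have -> : forall j, \sum_k \sum_a Num.conj (Ks k a j) * Ks k a i = (j == i)%:R
  by move=> j'; have /matrixP/(_ j' i) := Ks_channel; rewrite !mxE summxE => <-;
     apply: eq_bigr => k _; rewrite !mxE; apply: eq_bigr => a _; rewrite !mxE.
  by rewrite eqxx scale1r.
by rewrite ji scale0r.
Qed.

Lemma density_apply_left (A : 'M[C]_(din * dB)) : density A -> density (apply_left Ks A).
Proof.
move=> [hA pA tA]; split; [exact: hermitian_apply_left|exact: psd_apply_left|].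
by rewrite -mxtrace_ptrace ptrace_apply_left mxtrace_ptrace.
Qed.

End Tensor.

(** With a trivial share each Kraus operator is a column. Cauchy-Schwarz then costs its squared
    norm, and these norms sum to 1, so no dimension factor appears. *)
Lemma psd_ampliate_apply_left dB dout nK (Ks : 'I_nK -> 'M[C]_(dout, 1))
    (A : 'M[C]_(1 * dB)) :
  kraus_channel Ks -> psd A -> psd (ampliate dout A - apply_left Ks A).
Proof.
move=> Kc pA v.
rewrite -[X in 0 <= X]/(sesqui _ v v) sesquiBmx.
rewrite subr_ge0 sesqui_ampliate sesqui_summx.
set Z := \sum_(a < dout) _.
apply: le_trans (_ : \sum_k (\sum_a Num.conj (Ks k a 0) * Ks k a 0) * Z <= _).
  apply: ler_sum => k _; rewrite sesqui_conj.
  have -> : hadj (tensmx (Ks k) 1%:M) *m v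
      = \sum_a Num.conj (Ks k a 0) *: (hadj (slot dB a) *m v).
    have s1 : slot dB (0 : 'I_1) = 1%:M.
      by rewrite -tensmx11 /slot; congr tensmx; apply/matrixP => i j; rewrite !ord1 !mxE.
    rewrite -[tensmx _ _]mulmx1 -s1 tensmx_slot hadj_sum mulmx_suml.
    by apply: eq_bigr => a _; rewrite hadjZ scalemxAl.
  apply: le_trans (sesqui_cauchy_schwarz _ _ pA) _.
  by under eq_bigr do rewrite conjCK mulrC.
rewrite -mulr_suml.
have -> : \sum_k \sum_a Num.conj (Ks k a 0) * Ks k a 0 = 1.
  have /matrixP/(_ 0 0) := Kc; rewrite summxE !mxE eqxx mulr1n => <-.
  by apply: eq_bigr => k _; rewrite !mxE; apply: eq_bigr => a _; rewrite !mxE.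
by rewrite mul1r.
Qed.

End LoewnerOrder.

(** * From the logarithmic bound to binary entropy *)

Lemma binary_entropy_of_ln_bound (R : realType) (eps : R) (m p : nat) :
  0 < eps < 1 / 2 ->
  let t := (ln (1 - eps) - ln eps) / 2 in
  t * (m%:R * (1 - 2 * eps)) <= ln (2 ^+ p * (expR t + expR (- t)) ^+ m / 2 ^+ m) ->
  (1 - Hbin eps) * m%:R <= p%:R.
Proof.
(* Here [tanh t = 1 - 2 * eps] and [expR s] is the geometric mean of [eps] and [1 - eps]. As [t + s]
   and [- t + s] are [ln (1 - eps)] and [ln eps], the product [(expR t + expR (- t)) * expR s] is
   1. *)
move=> /andP[e0 e1] t; set s := (ln (1 - eps) + ln eps) / 2.
have e1' : 0 < 1 - eps by lra.
have -> : expR t + expR (- t) = expR (- s).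
  have : (expR t + expR (- t)) * expR s = 1.
    rewrite mulrDl -!expRD.
    have -> : t + s = ln (1 - eps) by rewrite /t /s; field.
    have -> : - t + s = ln eps by rewrite /t /s; field.
    by rewrite !lnK ?posrE // subrK.
  by move=> h; rewrite -[LHS]mulr1 -(expRxMexpNx_1 s) mulrA h mul1r.
have p2 k : 0 < 2 ^+ k :> R by rewrite exprn_gt0.
rewrite ln_div ?lnM ?posrE ?mulr_gt0 ?exprn_gt0 ?expR_gt0 //.
rewrite !lnXn ?expR_gt0 // expRK -![ln _ *+ _]mulr_natl -[(- s) *+ _]mulr_natl.
have l2 : 0 < ln 2 :> R by rewrite ln_gt0 // ltr1n.
rewrite /Hbin /log2 !div1r !lnV ?posrE // => h.
rewrite -(ler_pM2r l2).
have -> : (1 - (eps * (- ln eps / ln 2) + (1 - eps) * (- ln (1 - eps) / ln 2))) * m%:R * ln 2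
  = m%:R * (ln 2 + eps * ln eps + (1 - eps) * ln (1 - eps)).
  by field; rewrite lt0r_neq0.
move: h; rewrite /t /s; set a := ln eps; set c := ln (1 - eps); set l := ln 2.
move: (m%:R : R) (p%:R : R) => M P h.
rewrite -subr_ge0; by move: h; rewrite -subr_ge0; congr (0 <= _); field.
Qed.

(** * From a protocol to a random access code *)

Section Reduction.
Local Open Scope complex_scope.
Variables (R : realType) (n b' : nat) (f : {ffun 'I_n -> bool} -> bool).
Local Notation b := b'.+1.
Local Notation J := ('I_n * 'I_b')%type.

Definition rac_encode (u : {ffun J -> bool}) : IPinput n b :=
  [ffun i => [ffun k => if unlift ord0 k is Some k' then u (i, k') else true]].

Definition rac_query (z : 'I_n -> {ffun 'I_n -> bool}) (j : J) : IPinput n b :=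
  [ffun i => [ffun k => if i == j.1 then k == lift ord0 j.2 else (k == ord0) && z j.1 i]].

Lemma IP_point (x : {ffun 'I_b -> bool}) (k : 'I_b) (c : bool) :
  IP x [ffun l => (l == k) && c] = x k && c.
Proof.
rewrite /IP (bigD1 k) //= big1 => [|l /negPf lk]; rewrite ffunE ?lk ?andbF //.
by rewrite eqxx addbF.
Qed.

(** The query makes [f] see [z j.1] with coordinate [j.1] replaced by [u j], that is, [z j.1] or its
    flip. Sensitivity there means the output reveals [u j] up to a mask Bob knows. *)
Lemma rac_decode z (j : J) u : f (z j.1) != f (flip_at j.1 (z j.1)) ->
  composeIP f (rac_encode u) (rac_query z j) = u j (+) (f (z j.1) (+) z j.1 j.1).
Proof.
case: j => i k /= hz; rewrite /composeIP.
have -> : [ffun l => IP (rac_encode u l) (rac_query z (i, k) l)] =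
          [ffun l => if l == i then u (i, k) else z i l].
  apply/ffunP => l; rewrite !ffunE /=.
  case: eqP => [->|_]; last by rewrite IP_point ffunE unlift_none.
  have -> : [ffun k0 : 'I_b => k0 == lift ord0 k] = [ffun k0 => (k0 == lift ord0 k) && true].
    by apply/ffunP => l'; rewrite !ffunE andbT.
  by rewrite IP_point ffunE liftK andbT.
have [e|e] := eqVneq (u (i, k)) (z i i).
  have -> : [ffun l => if l == i then u (i, k) else z i l] = z i.
    by apply/ffunP => l; rewrite ffunE; case: eqP => // ->.
  by rewrite e addbC -addbA addbb addbF.
have -> : [ffun l => if l == i then u (i, k) else z i l] = flip_at i (z i).
  apply/ffunP => l; rewrite !ffunE; case: eqP => // ->.
  by move: e; case: (u (i, k)); case: (z i i).
by move: e hz; case: (u (i, k)); case: (z i i); case: (f (z i)); case: (f (flip_at i (z i))).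
Qed.

Variables (eps : R) (d p : nat) (rho P : IPinput n b -> 'M[R[i]]_d) (tau : 'M[R[i]]_d).
Hypothesis (f_dep : depends_on_all f) (eps_bound : 0 < eps < 1 / 2).
Hypothesis (rho_density : forall x, density (rho x)) (rho_le : forall x, psd (tau - rho x)).
Hypothesis (tau_herm : Defs.hermitian tau) (tau_psd : psd tau) (tau_tr : retr tau = 2 ^+ p).
Hypothesis (P_proj : forall y, Defs.projector (P y)).
Hypothesis (correct : forall x y,
  (1 - eps)%:C <= prob_out (P y) (rho x) (composeIP f x y)).

(** Common to both models, which differ only in the dominating [tau] and the exponent [p] of its
    trace. *)
Lemma dominated_protocol_bound : (1 - Hbin eps) * (n * b')%:R <= p%:R.
Proof.
pose z i := xchoose (f_dep i).
have zP i : f (z i) != f (flip_at i (z i)) := xchooseP (f_dep i).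
pose Q j := P (rac_query z j).
(* The reflection [1 - 2 Q] has value -1 on outcome [true]; the sign in front undoes the decoding
   mask. *)
pose H (j : J) : 'M[R[i]]_d :=
  ((-1) ^+ (f (z j.1) (+) z j.1 j.1) : R)%:C *: (1%:M - (Q j + Q j)).
have H_herm j : Defs.hermitian (H j).
  have [hP _] := P_proj (rac_query z j).
  by rewrite /Defs.hermitian hadjZ conj_real hadjD hadjN hadjD hadj1 hP.
have H_sqr j : H j *m H j = 1%:M.
  have [_ PP] := P_proj (rac_query z j).
  rewrite -scalemxAl -scalemxAr scalerA -rmorphM /= -expr2 sqrr_sign rmorph1 scale1r.
  have AA : (Q j + Q j) *m (Q j + Q j) = (Q j + Q j) + (Q j + Q j).
    by rewrite mulmxDl !mulmxDr PP.
  by rewrite mulmxBl mul1mx mulmxBr mulmx1 AA opprB addrK subrK.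
have bias u j : 1 - 2 * eps <= sgn R u j * retr (rho (rac_encode u) *m H j).
  rewrite -scalemxAr retrZ mulrA /sgn -signr_addb -(rac_decode _ (zP j.1)).
  have := correct (rac_encode u) (rac_query z j); rewrite lecE => /andP[_].
  have [_ _ tr1] := rho_density (rac_encode u).
  rewrite mulmxBr mulmxDr mulmx1 retrB retrD {1}/retr tr1 [complex.Re 1]/= /prob_out.
  set pr := retr _.
  have e : retr (Q j *m rho (rac_encode u)) = pr by rewrite /pr /retr mxtrace_mulC.
  case: composeIP; rewrite ?expr1 ?expr0 [complex.Re _%:C]/=.
    by rewrite -/(retr _) e => h; lra.
  by rewrite -/(retr _) mulmxBl mul1mx retrB e {1}/retr tr1 [complex.Re 1]/= => h; lra.
have [e0 e1] := andP eps_bound.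
(* This [t] solves [tanh t = 1 - 2 * eps], the choice that turns the moment bound into entropy. *)
have t0 : 0 <= (ln (1 - eps) - ln eps) / 2.
  by rewrite divr_ge0 // subr_ge0 ler_ln ?posrE; lra.
have delta0 : 0 <= 1 - 2 * eps by lra.
have tau0 : 0 < retr tau by rewrite tau_tr exprn_gt0.
have := rac_bound H_herm H_sqr tau_herm tau_psd (rho := fun u => rho (rac_encode u))
   (fun u => rho_density _) (fun u => rho_le _) delta0 bias t0 tau0.
rewrite tau_tr card_prod !card_ord; exact: binary_entropy_of_ln_bound.
Qed.

End Reduction.

(** * The two communication models *)

Unset Implicit Arguments.

Theorem theorem1p1 (R : realType) (n b : nat) (f : {ffun 'I_n -> bool} -> bool)
  (eps : R) :
  (1 <= n)%N -> (1 <= b)%N -> depends_on_all f -> 0 < eps < 1 / 2 ->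
  (forall q : nat, one_way_feasible false (@composeIP n b f) eps q ->
     (1 - Hbin eps) * n%:R * (b%:R - 1) <= q%:R) /\
  (forall q : nat, one_way_feasible true (@composeIP n b f) eps q ->
     (1 - Hbin eps) * n%:R * (b%:R - 1) / 2 <= q%:R).
Proof.
move=> _; case: b => // b' _ f_dep eps_bound.
have -> : (1 - Hbin eps) * n%:R * (b'.+1%:R - 1) = (1 - Hbin eps) * (n * b')%:R.
  by rewrite -natr1 addrK natrM mulrA.
have retr_of (d p : nat) (M : 'M[R[i]]_d) : \tr M = (2 ^ p)%N%:R -> retr M = 2 ^+ p.
  by rewrite /retr => ->; rewrite -(rmorph_nat (real_complex R)) /= natrX.
split=> q [dA [dB [sigma [dsigma dA1 [K [Ks [P [Kc Pp ok]]]]]]]].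
  move: sigma Ks dsigma Kc ok; rewrite dA1 // => sigma Ks dsigma Kc ok.
  have [hs ps ts] := dsigma.
  (* The trace of this [tau] is [2 ^ q], so [p = q]. *)
  apply: (dominated_protocol_bound (tau := ampliate (2 ^ q) sigma) f_dep eps_bound
    (fun x => density_apply_left (Kc x) dsigma) _ _ _ _ Pp ok).
  - by move=> x; apply: psd_ampliate_apply_left.
  - exact: hermitian_ampliate.
  - exact: psd_ampliate.
  - by apply: retr_of; rewrite mxtrace_ampliate ts mulr1.
have [hs ps ts] := dsigma; rewrite ler_pdivrMr // -natrM.
have rc : (2 ^ q)%N%:R = real_complex R (2 ^ q)%N%:R by rewrite rmorph_nat.
(* One factor [2 ^ q] of the trace comes from the scalar and one from the ampliation, so
   [p = 2 * q]; hence the halved bound. *)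
apply: (dominated_protocol_bound
  (tau := (2 ^ q)%N%:R *: ampliate (2 ^ q) (ptrace sigma)) f_dep eps_bound
  (fun x => density_apply_left (Kc x) dsigma) _ _ _ _ Pp ok).
- move=> x; rewrite -(ptrace_apply_left (Kc x)); apply: psd_ampliate_ptrace.
  exact: psd_apply_left.
- rewrite /Defs.hermitian hadjZ rc conj_real hermitian_ampliate //.
  exact: hermitian_ptrace.
- move=> v; rewrite -scalemxAr -scalemxAl mxE mulr_ge0 ?ler0n //.
  by apply: psd_ampliate; apply: psd_ptrace.
- apply: retr_of; rewrite mxtraceZ mxtrace_ampliate mxtrace_ptrace ts mulr1 -natrM.
  by rewrite -expnD muln2 addnn.
Qed.
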